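(* Let $(V,E)$ be a rooted directed tree, let $\mu=(\mu_v)_{v\in V}$ be a weight on $V$, and let $\mathcal{F}$ be a Furstenberg family on $\mathbb{N}_0$. Let $X=\ell^p(V,\mu)$, $1\leq p<+\infty$, or $X=c_0(V,\mu)$, and suppose that the backward shift $B$ is a bounded operator on $X$. For $v\in V$ and $N\in\mathbb{N}$ put $$A(v,N)=\begin{cases}\Big\{n\in\mathbb{N}_0:\ \sup_{u\in\mathrm{Chi}^n(v)}\frac{1}{|\mu_u|}>N\Big\} & \text{if } X=\ell^1(V,\mu),\\[2mm] \Big\{n\in\mathbb{N}_0:\ \Big(\sum_{u\in\mathrm{Chi}^n(v)}\frac{1}{|\mu_u|^{p^\ast}}\Big)^{1/p^\ast}>N\Big\} & \text{if } X=\ell^p(V,\mu),\ 1<p<+\infty,\\[2mm] \Big\{n\in\mathbb{N}_0:\ \sum_{u\in\mathrm{Chi}^n(v)}\frac{1}{|\mu_u|}>N\Big\} & \text{if } X=c_0(V,\mu).\end{cases}$$ Then the following assertions are equivalent: (1) $B$ is $\widetilde{\mathcal{F}}$-transitive. (2) $B$ is $\mathcal{F}$-transitive. (3) There exists a bounded subset $C\subset X\setminus\{0\}$ such that for every nonempty weakly open subset $W\subset X$, $N(C,W)\in\mathcal{F}$. (4) For every $N\in\mathbb{N}$ and every finite subset $F\subset V$, $\bigcap_{v\in F}A(v,N)\in\mathcal{F}$. If $\mathcal{F}$ satisfies that $A\cap[n,+\infty[\,\in\mathcal{F}$ whenever $A\in\mathcal{F}$ and $n\in\mathbb{N}$, then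 conditions (1)-(4) are equivalent to: (5) For every $g\in X$, every open neighborhood $U$ of $g$ and every weakly open neighborhood $W$ of $g$, $N(U,W)\in\mathcal{F}$. If $\mathcal{F}$ is a filter, then conditions (1)-(4) are equivalent to: (6) For every $N\in\mathbb{N}$ and every $v\in V$, $A(v,N)\in\mathcal{F}$.
   Context: $\mathbb{N}_0=\{0,1,2,\ldots\}$, $\mathbb{N}=\mathbb{N}_0\setminus\{0\}$, $\mathbb{K}$ is $\mathbb{R}$ or $\mathbb{C}$. Directed tree: a pair $(V,E)$ with $V$ a non-empty countable set (vertices) and $E\subset\{(u,v):u,v\in V,u\neq v\}$ (edges) such that: (i) any two distinct vertices are joined by an undirected path; (ii) there is no circuit, i.e. no sequence $v_1,\ldots,v_n$ of distinct vertices, $n\geq2$, with $(v_j,v_{j+1})\in E$ for $1\le j<n$ and $(v_n,v_1)\in E$; (iii) for each $v\in V$ there is at most one $u\in V$ with $(u,v)\in E$; if it exists it is called the parent of $v$, denoted $\mathrm{par}(v)$. A root is a vertex without parent (there is at most one); the tree is rooted if it has a root. $\mathrm{Chi}(v)=\{u\in V:\mathrm{par}(u)=v\}$, $\mathrm{Chi}^0(v)=\{v\}$, $\mathrm{Chi}^1(v)=\mathrm{Chi}(v)$, $\mathrm{Chi}^n(v)=\bigcup_{u\in\mathrm{Chi}(v)}\mathrm{Chi}^{n-1}(u)$ for $n\geq2$. Weight on $V$: a family $\mu=(\mu_v)_{v\in V}$ of non-zero numbers in $\mathbb{K}$. $\ell^p(V,\mu)=\{f\in\mathbb{K}^V:\|f\|_{p,\mu}^p=\sum_{v}|f(v)\mu_v|^p<+\infty\}$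 with norm $\|\cdot\|_{p,\mu}$; $c_0(V,\mu)$ is the set of $f\in\mathbb{K}^V$ such that for every $\varepsilon>0$ there is a finite $F\subset V$ with $|f(v)\mu_v|<\varepsilon$ for all $v\in V\setminus F$, with norm $\sup_v|f(v)\mu_v|$. For $1<p<\infty$, $p^\ast=p/(p-1)$. The backward shift is $(Bf)(v)=\sum_{u\in\mathrm{Chi}(v)}f(u)$. An empty sum is $0$, the supremum of the empty set is $0$; sums of non-negative numbers and suprema may equal $+\infty$. Furstenberg family on $\mathbb{N}_0$: a non-empty family $\mathcal{F}$ of infinite subsets of $\mathbb{N}_0$ such that $A\in\mathcal{F}$, $A\subset A'\subset\mathbb{N}_0$ imply $A'\in\mathcal{F}$. It is a filter if moreover it is closed under intersections of two members. $\widetilde{\mathcal{F}}$ is the family of $A\subset\mathbb{N}_0$ such that for every $N\in\mathbb{N}_0$ there is $D\in\mathcal{F}$ with $(D+\{-N,\ldots,N\})\cap\mathbb{N}_0\subset A$. For subsets $U,W\subset X$, $N(U,W)=\{n\in\mathbb{N}_0:B^n(U)\cap W\neq\emptyset\}$. For a family $\mathcal{G}$ of subsets of $\mathbb{N}_0$, $B$ is $\mathcal{G}$-transitive if $N(U,W)\in\mathcal{G}$ for all nonempty (norm-)open $U,W\subset X$. The intersection over $F=\emptyset$ is $\mathbb{N}_0$. *)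

(* Defs.v *)
Set Warnings "-notation-overridden,-notation-incompatible-prefix".
From HB Require Import structures.
From mathcomp Require Import all_boot all_order all_algebra.
From mathcomp Require Import finmap complex.
From mathcomp Require Import all_classical all_reals all_analysis.
From mathcomp.analysis.showcase Require Import summability.

Set Implicit Arguments.
Unset Strict Implicit.
Unset Printing Implicit Defensive.

Import Order.TTheory GRing.Theory Num.Theory.
Import numFieldNormedType.Exports.

Local Open Scope classical_set_scope.
Local Open Scope ring_scope.

Section DirectedTree.
Context {V : countType}.
Implicit Type E : rel V.

Record directed_tree E : Prop := DirectedTree {
  tree_nonempty : [set: V] !=set0 ;
  tree_irreflexive : forall u, ~~ E u u ;
  tree_connected : forall u v, u != v ->
    exists s : seq V, path (fun x y => E x y || E y x) u s /\ last u s = v ;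
  (* [cycle E s] also requires the edge from the last vertex to the first *)
  tree_no_circuit : forall s : seq V, (2 <= size s)%N -> uniq s -> ~~ cycle E s ;
  tree_parent_unique : forall u u' v, E u v -> E u' v -> u = u' }.

Definition tree_root E (v : V) : Prop := forall u, ~~ E u v.

Definition rooted E : Prop := exists v, tree_root E v.

Definition Chi E (v : V) : set V := [set u | E v u].

Fixpoint Chin E (n : nat) (v : V) : set V :=
  if n is m.+1 then \bigcup_(u in Chi E v) Chin E m u else [set v].

End DirectedTree.

Variant scalar_kind := RealScalars | ComplexScalars.

Definition scalar_field (R : realType) (k : scalar_kind) : numFieldType :=
  match k with RealScalars => R | ComplexScalars => R[i] end.

(* The library norm of R[i] takes its values in R[i]; weights, exponents and
   sums below need the modulus as an element of R. *)
Definition modulus {R : realType} {k : scalar_kind} : scalar_field R k -> R :=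
  match k with
  | RealScalars => fun x : R => `|x|
  | ComplexScalars => fun z : R[i] => Normc.normc z
  end.

Variant seq_space (R : realType) := ell (p : R) | c_zero.
Arguments c_zero {R}.

Definition exponent_ok {R : realType} (X : seq_space R) : Prop :=
  match X with ell p => 1 <= p | c_zero => True end.

Section WeightedSpaces.
Context {R : realType} {k : scalar_kind} {V : countType}.
Local Notation K := (scalar_field R k).
Variables (X : seq_space R) (mu : V -> K).
Implicit Types (f g : V -> K) (U W C : set (V -> K)).

(* X is the space [ell p] or [c_zero] over V with weight mu, as a subset of the
   space of all functions V -> K. *)
Definition wspace : set (V -> K) :=
  match X with
  | ell p => [set f |
      (\esum_(v in [set: V]) ((modulus (f v * mu v)) `^ p)%:E < +oo)%E]
  | c_zero => [set f | forall e : R, 0 < e ->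
      exists2 F : set V, finite_set F &
        forall v, ~ F v -> modulus (f v * mu v) < e]
  end.

(* Only meaningful for f in [wspace]. *)
Definition space_norm f : R :=
  match X with
  | ell p => (fine (\esum_(v in [set: V]) ((modulus (f v * mu v)) `^ p)%:E))
               `^ p^-1
  | c_zero => sup [set modulus (f v * mu v) | v in [set: V]]
  end.

Definition norm_open U : Prop :=
  U `<=` wspace /\
  forall f, U f -> exists2 e : R, 0 < e &
    forall g, wspace g -> space_norm (g \- f) < e -> U g.

Definition norm_bounded C : Prop :=
  C `<=` wspace /\ exists M : R, forall f, C f -> space_norm f <= M.

(* Elements of the topological dual; only the values on [wspace] matter. *)
Definition dual_functional (phi : (V -> K) -> K) : Prop :=
  (forall (a : K) f g, wspace f -> wspace g ->
     phi (fun v => a * f v + g v) = a * phi f + phi g) /\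
  exists M : R, forall f, wspace f -> modulus (phi f) <= M * space_norm f.

Definition weakly_open W : Prop :=
  W `<=` wspace /\
  forall f, W f -> exists (m : nat) (phi : 'I_m -> (V -> K) -> K) (e : R),
    [/\ forall i, dual_functional (phi i), 0 < e &
        forall g, wspace g ->
          (forall i, modulus (phi i g - phi i f) < e) -> W g].

End WeightedSpaces.

Section BackwardShift.
Context {R : realType} {k : scalar_kind} {V : countType}.
Local Notation K := (scalar_field R k).
Variable E : rel V.
Implicit Types (f : V -> K) (U W : set (V -> K)).

Definition child_terms f (v : V) : V -> K := fun u => if E v u then f u else 0.

(* A vertex may have infinitely many children, so this is an unordered infinite
   sum; it is a junk value when the net of finite partial sums diverges. *)
Definition backward_shift f : V -> K := fun v => sum (child_terms f v).

Definition bounded_backward_shift (X : seq_space R) (mu : V -> K) : Prop :=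
  [/\ forall f, wspace X mu f ->
        forall v, cvg (partial_sum (child_terms f v) @ totally),
      forall f, wspace X mu f -> wspace X mu (backward_shift f) &
      exists M : R, forall f, wspace X mu f ->
        space_norm X mu (backward_shift f) <= M * space_norm X mu f].

Definition return_set U W : set nat :=
  [set n | (iter n backward_shift @` U) `&` W !=set0].

Definition set_transitive (X : seq_space R) (mu : V -> K) (G : set (set nat)) :
    Prop :=
  forall U W, norm_open X mu U -> norm_open X mu W ->
    U !=set0 -> W !=set0 -> G (return_set U W).

(* The quantity compared with N in the definition of A(v,N).  Adjoining 0 makes
   the supremum of the empty set equal to 0. *)
Definition inverse_weight_size (X : seq_space R) (mu : V -> K) (v : V)
    (n : nat) : \bar R :=
  match X with
  | ell p =>
      if p == 1 then
        ereal_sup (0%E |` [set ((modulus (mu u))^-1)%:E | u in Chin E n v])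
      else
        let q := p / (p - 1) in
        ((\esum_(u in Chin E n v) (((modulus (mu u)) `^ q)^-1)%:E) `^ q^-1)%E
  | c_zero => (\esum_(u in Chin E n v) ((modulus (mu u))^-1)%:E)%E
  end.

Definition A_set (X : seq_space R) (mu : V -> K) (v : V) (N : nat) : set nat :=
  [set n | (N%:R%:E < inverse_weight_size X mu v n)%E].

End BackwardShift.

Record furstenberg_family (F : set (set nat)) : Prop := FurstenbergFamily {
  furstenberg_nonempty : F !=set0 ;
  furstenberg_infinite : forall A, F A -> infinite_set A ;
  furstenberg_upward : forall A A', F A -> A `<=` A' -> F A' }.

Definition family_filter (F : set (set nat)) : Prop :=
  forall A A', F A -> F A' -> F (A `&` A').

(* [set m | ...] is (D + {-N,...,N}) intersected with the natural numbers *)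
Definition tilde (F : set (set nat)) : set (set nat) :=
  [set A | forall N : nat, exists2 D, F D &
    [set m | exists2 d, D d & (m <= d + N)%N && (d <= m + N)%N] `<=` A].

(* Main.v *)
(* Write q_n(v) for the quantity defining A(v,N).  Hölder duality identifies q_n(v)
   with the norm of f |-> (B^n f)(v): if q_n(v) > N, some e supported in Chi^n(v)
   satisfies B^n e = delta_v and N ||e|| < 1; conversely N ||f|| < |(B^n f)(v)|
   forces q_n(v) > N.

   The converse half gives (3) => (4) and (5) => (4).  For (4) => (1), truncate
   to finitely supported g in U and h in W.  As the tree is rooted, B^n g = 0 for
   n large, so that g + sum_v h(v) e_v lies in U and is mapped by B^n to h.  The
   n0 excluded at the start and the window {-M,...,M} cost nothing: applying (4)
   at a descendant w in Chi^M(v), a vector lifting delta_w at time d lifts delta_v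
   at time d + M, hence, after applying powers of B, at every time within M of d;
   and N ||e|| < 1 with N large forces d to be large because B is bounded. *)
Require Import Defs.
Set Warnings "-notation-overridden,-notation-incompatible-prefix".
From HB Require Import structures.
From mathcomp Require Import all_boot all_order all_algebra.
From mathcomp Require Import finmap complex ring lra.
From mathcomp Require Import all_classical all_reals all_analysis.
From mathcomp.analysis.showcase Require Import summability.

Set Implicit Arguments.
Unset Strict Implicit.
Unset Printing Implicit Defensive.

Import Order.TTheory GRing.Theory Num.Theory.
Import numFieldNormedType.Exports.

Local Open Scope classical_set_scope.
Local Open Scope ring_scope.

(** * Scalars and unordered sums *)

Section Modulus.
Context {R : realType} {k : scalar_kind}.
Local Notation K := (scalar_field R k).
Implicit Types x y : K.

Lemma modulus_ge0 x : 0 <= modulus x.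
Proof. by case: k x => [x|[a b]] /=; rewrite ?normr_ge0 ?sqrtr_ge0. Qed.

Lemma modulus0 : modulus (0 : K) = 0.
Proof. by case: k => /=; [rewrite normr0|exact: Normc.normc0]. Qed.

Lemma modulus1 : modulus (1 : K) = 1.
Proof. by case: k => /=; [rewrite normr1|exact: Normc.normc1]. Qed.

Lemma modulusM x y : modulus (x * y) = modulus x * modulus y.
Proof. by case: k x y => x y /=; [rewrite normrM|exact: Normc.normcM]. Qed.

Lemma modulusN x : modulus (- x) = modulus x.
Proof. by case: k x => x /=; [rewrite normrN|exact: normcN]. Qed.

Lemma ler_modulusD x y : modulus (x + y) <= modulus x + modulus y.
Proof. by case: k x y => x y /=; [exact: ler_normD|exact: le_normcD]. Qed.

Lemma modulus_eq0 x : modulus x = 0 -> x = 0.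
Proof. by case: k x => x /=; [exact: normr0_eq0|exact: Normc.eq0_normc]. Qed.

Lemma modulus_gt0 x : x != 0 -> 0 < modulus x.
Proof.
move=> x0; rewrite lt_neqAle modulus_ge0 andbT eq_sym.
by apply: contra x0 => /eqP/modulus_eq0 ->.
Qed.

Lemma ler_modulusB x y : modulus x - modulus y <= modulus (x - y).
Proof. by rewrite lerBlDr (le_trans _ (ler_modulusD _ _)) ?subrK. Qed.

Lemma ler_modulus_sum (I : Type) (s : seq I) (P : pred I) (f : I -> K) :
  modulus (\sum_(i <- s | P i) f i) <= \sum_(i <- s | P i) modulus (f i).
Proof.
elim/big_ind2 : _ => [|x a y b xa yb|//]; first by rewrite modulus0.
exact: le_trans (ler_modulusD _ _) (lerD xa yb).
Qed.

Definition of_real : R -> K :=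
  match k return R -> scalar_field R k with
  | RealScalars => fun a => a
  | ComplexScalars => fun a => a%:C%C
  end.

Lemma of_realD a b : of_real (a + b) = of_real a + of_real b.
Proof. by rewrite /of_real; case: k => //=; rewrite rmorphD. Qed.

Lemma of_real0 : of_real 0 = 0.
Proof. by rewrite /of_real; case: k. Qed.

Lemma of_real1 : of_real 1 = 1.
Proof. by rewrite /of_real; case: k. Qed.

Lemma of_real_sum (I : Type) (s : seq I) (f : I -> R) :
  of_real (\sum_(i <- s) f i) = \sum_(i <- s) of_real (f i).
Proof. by elim/big_rec2 : _ => [|i x y _ <-]; rewrite ?of_real0 ?of_realD. Qed.

Lemma modulus_of_real a : modulus (of_real a) = `|a|.
Proof.
rewrite /of_real /modulus; case: k => //=.
by rewrite expr0n addr0 sqrtr_sqr.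
Qed.

End Modulus.

Section UnorderedSum.
#[local] Existing Instance totally_filter.
Context {K : numFieldType} {I : choiceType}.
Implicit Types x y : I -> K.

Lemma partial_sumE x (A : {fset I}) : partial_sum x A = \sum_(i <- A) x i.
Proof. by rewrite [RHS]big_seq_fsetE. Qed.

(** Partial sums over finite sets containing [i] all equal [x i], so the net is eventually
    constant. *)
Lemma sum_at x i : (forall j, j != i -> x j = 0) -> sum (x : I -> K^o) = x i.
Proof.
move=> x0; apply: lim_near_cst; first exact: norm_hausdorff.
near=> A; have : ([fset i] `<=` A)%fset by near: A; exists [fset i]%fset.
rewrite fsub1set => iA.
rewrite partial_sumE (big_fsetD1 i) //= big1_fset ?addr0 // => j.
by rewrite !inE => /andP[ji _] _; exact: x0.
Unshelve. all: by end_near.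
Qed.

(** Additivity of limits along the net of finite subsets. Both nets are required to converge because
    [sum] is a junk value otherwise. *)
Lemma sum_linear a x y :
  cvg (partial_sum x @ totally) -> cvg (partial_sum y @ totally) ->
  sum ((fun i => a * x i + y i) : I -> K^o) =
  a * sum (x : I -> K^o) + sum (y : I -> K^o).
Proof.
move=> cx cy.
apply: cvg_lim => //.
rewrite [X in X @ _](_ : _ = (a \*: (partial_sum x : _ -> K^o)) + partial_sum y); last first.
  by apply/funext => A; rewrite /= !partial_sumE big_split/= -mulr_sumr -!partial_sumE.
by apply: (@cvgD K K^o); [apply: cvgZl_tmp|].
Qed.

End UnorderedSum.

(** * Finite sums of powers *)

Section FiniteSums.
Context {R : realType} {V : choiceType}.
Implicit Types (a b : V -> R) (s : seq V) (p : R).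

Lemma powR_div (x c r : R) : 0 <= x -> 0 < c -> (x / c) `^ r = x `^ r / c `^ r.
Proof.
move=> x0 c0; have c'0 : 0 <= c^-1 by rewrite invr_ge0 ltW.
rewrite powRM//; congr (_ * _).
by rewrite -(powR_inv1 (ltW c0)) powRAC powR_inv1 // powR_ge0.
Qed.

(** Convexity of the p-th power at (x + y) / (α + β), which is the convex combination of x / α and y
    / β with weights α / (α + β) and β / (α + β). *)
Lemma powRD_le_convex (p x y α β : R) : 1 <= p -> 0 <= x -> 0 <= y -> 0 < α -> 0 < β ->
  (x + y) `^ p <= (α + β) `^ p *
    (α / (α + β) * (x `^ p / α `^ p) + β / (α + β) * (y `^ p / β `^ p)).
Proof.
move=> p1 x0 y0 α0 β0; have αβ0 : 0 < α + β by rewrite addr_gt0.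
have t01 : 0 <= α / (α + β) <= 1.
  apply/andP; split; first by rewrite divr_ge0 ?ltW.
  by rewrite ler_pdivrMr// mul1r lerDl ltW.
have/andP[tge0 tle1] := t01.
have xa : 0 <= x / α by rewrite divr_ge0 // ltW.
have yb : 0 <= y / β by rewrite divr_ge0 // ltW.
have mem (z : R) : 0 <= z -> z \in (`[0, +oo[%classic : set R).
  by move=> z0; rewrite inE/= in_itv/= z0.
have : (α / (α + β) * (x / α) + (1 - α / (α + β)) * (y / β)) `^ p <=
    α / (α + β) * (x / α) `^ p + (1 - α / (α + β)) * (y / β) `^ p.
  exact: (convex_powR p1 (Itv01 tge0 tle1) (mem _ xa) (mem _ yb)).
have -> : 1 - α / (α + β) = β / (α + β) by field; rewrite gt_eqF.
have -> : α / (α + β) * (x / α) + β / (α + β) * (y / β) = (x + y) / (α + β).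
  by field; rewrite !gt_eqF.
rewrite !powR_div ?addr_ge0// => h.
by rewrite mulrC -ler_pdivrMr ?powR_gt0.
Qed.

(** Summing [powRD_le_convex] gives (α + β)^p times a convex combination of two quotients at most 1.
    Upper bounds α and β replace the norms, so that they can be taken positive even when a norm is
    0. *)
Lemma minkowski_seq p a b s α β : 1 <= p -> (forall v, 0 <= a v) ->
  (forall v, 0 <= b v) -> 0 < α -> 0 < β ->
  \sum_(v <- s) a v `^ p <= α `^ p -> \sum_(v <- s) b v `^ p <= β `^ p ->
  \sum_(v <- s) (a v + b v) `^ p <= (α + β) `^ p.
Proof.
move=> p1 a0 b0 α0 β0 sa sb; have αβ0 : 0 < α + β by rewrite addr_gt0.
apply: (@le_trans _ _ (\sum_(v <- s) (α + β) `^ p *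
    (α / (α + β) * (a v `^ p / α `^ p) + β / (α + β) * (b v `^ p / β `^ p)))).
  by apply: ler_sum => v _; exact: powRD_le_convex.
rewrite -mulr_sumr -[leRHS]mulr1 ler_wpM2l ?powR_ge0// big_split/=.
have -> : 1 = α / (α + β) * 1 + β / (α + β) * 1 :> R.
  by rewrite !mulr1 -mulrDl divff// gt_eqF.
rewrite -!mulr_sumr -!mulr_suml; apply: lerD.
- by rewrite ler_wpM2l ?divr_ge0 ?(ltW α0) ?(ltW αβ0)// ler_pdivrMr ?mul1r // powR_gt0.
- by rewrite ler_wpM2l ?divr_ge0 ?(ltW β0) ?(ltW αβ0)// ler_pdivrMr ?mul1r // powR_gt0.
Qed.

(** Young's inequality for the normalised entries a v / α and b v / β; after summation the two terms
    contribute at most 1/p + 1/q = 1. *)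
Lemma hoelder_seq p q a b s α β : 0 < p -> 0 < q -> p^-1 + q^-1 = 1 ->
  (forall v, 0 <= a v) -> (forall v, 0 <= b v) -> 0 < α -> 0 < β ->
  \sum_(v <- s) a v `^ p <= α `^ p -> \sum_(v <- s) b v `^ q <= β `^ q ->
  \sum_(v <- s) a v * b v <= α * β.
Proof.
move=> p0 q0 pq a0 b0 α0 β0 sa sb.
apply: (@le_trans _ _ (\sum_(v <- s) α * β *
    (a v `^ p / α `^ p / p + b v `^ q / β `^ q / q))).
  apply: ler_sum => v _.
  have -> : a v * b v = α * β * (a v / α * (b v / β)).
    by field; rewrite !gt_eqF.
  rewrite ler_wpM2l ?mulr_ge0 ?(ltW α0) ?(ltW β0)// -!powR_div//.
  by apply: conjugate_powR => //; rewrite divr_ge0// ltW.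
rewrite -mulr_sumr -[leRHS]mulr1 ler_wpM2l ?mulr_ge0 ?(ltW α0) ?(ltW β0)// big_split/= -pq.
rewrite -!mulr_suml; apply: lerD; rewrite -[leRHS]mul1r ler_wpM2r ?invr_ge0 ?(ltW p0) ?(ltW q0)//.
- by rewrite ler_pdivrMr ?mul1r // powR_gt0.
- by rewrite ler_pdivrMr ?mul1r // powR_gt0.
Qed.

Lemma sum_le_esum (T : set V) a s : (forall v, 0 <= a v) -> uniq s ->
  {in s, forall v, T v} ->
  ((\sum_(v <- s) a v)%:E <= \esum_(v in T) (a v)%:E)%E.
Proof.
move=> a0 us sT; apply: esum_ge; exists [set` s].
  by split=> // v /= /sT.
by rewrite -fsbig_seq// sumEFin.
Qed.

(** An [esum] is a supremum of finite sums, so any number strictly below it is exceeded by one of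
    them. *)
Lemma lt_esum (T : set V) a (x : R) : (forall v, 0 <= a v) ->
  (x%:E < \esum_(v in T) (a v)%:E)%E ->
  exists s, [/\ uniq s, {in s, forall v, T v} & x < \sum_(v <- s) a v].
Proof.
move=> a0 /ereal_sup_gt[_ [A [finA AT] <-]] xA.
exists (fset_set A); split; first exact: fset_uniq.
  by move=> v; rewrite in_fset_set// inE => /AT.
by rewrite -lte_fin -sumEFin -fsbig_finite.
Qed.

End FiniteSums.

(** * Norms of non-negative families *)

Section SequenceNorm.
Context {R : realType} {V : choiceType}.
Variable X : seq_space R.
Hypothesis X_ok : exponent_ok X.
Implicit Types (a b : V -> R) (M : R) (s : seq V).

Definition vanishing a : Prop := forall e : R, 0 < e ->
  exists2 F : set V, finite_set F & forall v, ~ F v -> a v < e.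

Definition lspace a : Prop :=
  match X with
  | ell p => (\esum_(v in [set: V]) (a v `^ p)%:E < +oo)%E
  | c_zero => vanishing a
  end.

Definition lnorm a : R :=
  match X with
  | ell p => (fine (\esum_(v in [set: V]) (a v `^ p)%:E)) `^ p^-1
  | c_zero => sup [set a v | v in [set: V]]
  end.

(* The inequality lnorm a <= M for a in lspace, phrased through finite sums so
   that no esum or sup occurs in the proofs; see lball_lnorm and lnorm_le. *)
Definition lball M a : Prop :=
  match X with
  | ell p => forall s, uniq s -> \sum_(v <- s) a v `^ p <= M `^ p
  | c_zero => vanishing a /\ forall v, a v <= M
  end.

Lemma lnorm_ge0 a : (forall v, 0 <= a v) -> 0 <= lnorm a.
Proof.
move=> a0; rewrite /lnorm; case: X => [p|]; first exact: powR_ge0.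
(* If [V] is empty or [a] is unbounded, [sup] takes its default value 0. *)
have [[[_ [v _ _]] ub]|/sup_out ->//] := pselect (has_sup [set a v | v in [set: V]]).
by rewrite (le_trans (a0 v))// ub_le_sup//; exists v.
Qed.

Lemma lball_lnorm a : (forall v, 0 <= a v) -> lspace a -> lball (lnorm a) a.
Proof.
move=> a0; rewrite /lspace /lnorm /lball.
move: X_ok; case: X => [p /= p1 afin s us|_ ac].
  have p0 : 0 < p by exact: lt_le_trans p1.
  have e0 : (0 <= \esum_(v in [set: V]) (a v `^ p)%:E)%E.
    by apply: esum_ge0 => v _; rewrite lee_fin powR_ge0.
  rewrite -powRrM mulVf ?gt_eqF// powRr1 ?fine_ge0//.
  rewrite -lee_fin fineK ?ge0_fin_numE//.
  by apply: sum_le_esum => // v; exact: powR_ge0.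
split=> // v; apply: ub_le_sup; last by exists v.
(* A vanishing family is bounded: by 1 off the finite set [F], and on [F] by the sum of its values
   there. *)
have [F finF aF] := ac _ ltr01.
exists (1 + \sum_(u <- fset_set F) a u) => _ [u _ <-].
have [Fu|nFu] := pselect (F u); last first.
  by rewrite (le_trans (ltW (aF _ nFu)))// lerDl sumr_ge0.
rewrite (big_fsetD1 u) ?in_fset_set ?inE//= addrCA lerDl.
by rewrite addr_ge0// sumr_ge0.
Qed.

Lemma lball_lspace M a : (forall v, 0 <= a v) -> lball M a -> lspace a.
Proof.
move=> a0; rewrite /lspace /lball.
case: X => [p aM|[]//]; apply: (@le_lt_trans _ _ (M `^ p)%:E); last exact: ltry.
rewrite leNgt; apply/negP => /lt_esum[v|s [us _]]; first exact: powR_ge0.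
by rewrite ltNge aM.
Qed.

Lemma lnorm_le M a : (forall v, 0 <= a v) -> 0 <= M -> lball M a ->
  lnorm a <= M.
Proof.
move=> a0 M0 aM; have := lball_lspace a0 aM; move: aM.
rewrite /lspace /lnorm /lball.
move: X_ok; case: X => [p /= p1 aM afin|_ [_ aM] _].
  have p0 : 0 < p by exact: lt_le_trans p1.
  have e0 : (0 <= \esum_(v in [set: V]) (a v `^ p)%:E)%E.
    by apply: esum_ge0 => v _; rewrite lee_fin powR_ge0.
  have <- : (M `^ p) `^ p^-1 = M by rewrite -powRrM divff ?gt_eqF// powRr1.
  apply: ge0_ler_powR; rewrite ?nnegrE ?fine_ge0 ?powR_ge0 ?invr_ge0 ?(ltW p0)//.
  rewrite -lee_fin fineK ?ge0_fin_numE// leNgt; apply/negP.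
  move=> /lt_esum[v|s [us _]]; first exact: powR_ge0.
  by rewrite ltNge aM.
have [[ne _]|/sup_out ->//] := pselect (has_sup [set a v | v in [set: V]]).
by apply: ge_sup => // _ [v _ <-].
Qed.

Lemma lball_le M a b : (forall v, 0 <= a v) -> (forall v, a v <= b v) ->
  lball M b -> lball M a.
Proof.
move=> a0 ab; rewrite /lball /lspace.
move: X_ok; case: X => [p /= p1 bM s us|_ [bc bM]].
  apply: le_trans (bM s us); apply: ler_sum => v _.
  by rewrite ge0_ler_powR ?nnegrE ?(le_trans _ p1)// (le_trans _ (ab v)).
split=> [e /bc[F finF bF]|v]; last exact: le_trans (ab v) (bM v).
by exists F => // v /bF; exact: le_lt_trans.
Qed.

Lemma lball_monoR M N a : 0 <= M -> M <= N -> lball M a -> lball N a.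
Proof.
move=> M0 MN; rewrite /lball; move: X_ok; case: X => [p /= p1 aM s us|_ [ac aM]].
  apply: le_trans (aM s us) _.
  by rewrite ge0_ler_powR ?nnegrE ?(le_trans _ p1)// (le_trans _ MN).
by split=> // v; exact: le_trans MN.
Qed.

Lemma lballD M N a b : (forall v, 0 <= a v) -> (forall v, 0 <= b v) ->
  0 < M -> 0 < N -> lball M a -> lball N b -> lball (M + N) (fun v => a v + b v).
Proof.
move=> a0 b0 M0 N0; rewrite /lball /lspace.
move: X_ok; case: X => [p /= p1 aM bN s us|_ [ac aM] [bc bN]].
  by apply: minkowski_seq => //; [exact: aM|exact: bN].
split=> [e e0|v]; last by rewrite lerD.
have [F finF aF] := ac _ (divr_gt0 e0 (ltr0Sn R 1)).
have [G finG bG] := bc _ (divr_gt0 e0 (ltr0Sn R 1)).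
exists (F `|` G); first by rewrite finite_setU.
by move=> v /not_orP[/aF av /bG bv]; rewrite [e]splitr ltrD.
Qed.

Lemma lballZ M c a : (forall v, 0 <= a v) -> 0 < c -> 0 <= M -> lball M a ->
  lball (c * M) (fun v => c * a v).
Proof.
move=> a0 c0 M0; rewrite /lball /lspace.
move: X_ok; case: X => [p /= p1 aM s us|_ [ac aM]].
  rewrite powRM ?(ltW c0)//.
  under eq_bigr do rewrite powRM ?(ltW c0)//.
  by rewrite -mulr_sumr ler_wpM2l ?powR_ge0// aM.
split=> [e e0|v]; last by rewrite ler_wpM2l ?(ltW c0).
have [F finF aF] := ac _ (divr_gt0 e0 c0).
by exists F => // v /aF; rewrite ltr_pdivlMr// mulrC.
Qed.

Lemma lball_eval M a v : (forall v, 0 <= a v) -> 0 <= M -> lball M a -> a v <= M.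
Proof.
move=> a0 M0; rewrite /lball.
move: X_ok; case: X => [p /= p1 aM|_ [//]].
have p0 : 0 < p by exact: lt_le_trans p1.
have := aM [:: v] isT; rewrite big_seq1 => avM.
rewrite leNgt; apply/negP => Mav; move: avM; rewrite leNgt => /negP; apply.
by apply: gt0_ltr_powR; rewrite ?nnegrE.
Qed.

(** For [ell p], a finite sum within e^p of the total leaves a tail of p-th powers at most e^p; for
    [c_zero], the finite set comes from the vanishing condition at [e]. *)
Lemma lball_tail a e : (forall v, 0 <= a v) -> lspace a -> 0 < e ->
  exists2 s, uniq s & lball e (fun v => if v \in s then 0 else a v).
Proof.
move=> a0 + e0; rewrite /lspace /lball.
move: X_ok; case: X => [p /= p1 afin|_ ac].
  have p0 : 0 < p by exact: lt_le_trans p1.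
  have ap0 v : 0 <= a v `^ p by exact: powR_ge0.
  have E0 : (0 <= \esum_(v in [set: V]) (a v `^ p)%:E)%E.
    by apply: esum_ge0 => v _; rewrite lee_fin.
  have Efin : \esum_(v in [set: V]) (a v `^ p)%:E \is a fin_num by rewrite ge0_fin_numE.
  have : ((fine (\esum_(v in [set: V]) (a v `^ p)%:E) - e `^ p)%:E <
          \esum_(v in [set: V]) (a v `^ p)%:E)%E.
    by rewrite -[ltRHS]fineK// lte_fin ltrBlDr ltrDl powR_gt0.
  move=> /(lt_esum ap0)[s [us _ sE]]; exists s => // t ut.
  have -> : \sum_(v <- t) (if v \in s then 0 else a v) `^ p =
            \sum_(v <- [seq v <- t | v \notin s]) a v `^ p.
    rewrite big_filter [RHS]big_mkcond/=; apply: eq_bigr => v _.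
    by case: (v \in s) => //=; rewrite powR0// gt_eqF.
  (* The entries of [t] outside [s] are disjoint from [s], so both lists together form one finite
     sum, bounded by the total. *)
  have u : uniq (s ++ [seq v <- t | v \notin s]).
    rewrite cat_uniq us filter_uniq// andbT/=.
    by apply/hasPn => v; rewrite mem_filter => /andP[].
  have : ((\sum_(v <- s ++ [seq v <- t | v \notin s]) a v `^ p)%:E <=
      \esum_(v in [set: V]) (a v `^ p)%:E)%E by exact: sum_le_esum.
  rewrite -[leRHS]fineK// lee_fin big_cat/=; move: sE; lra.
have [F finF aF] := ac _ e0.
have sF v : v \notin fset_set F -> ~ F v.
  by rewrite in_fset_set//; apply: contraNnot; rewrite inE.
exists (fset_set F); first exact: fset_uniq.
split=> [d /ac[G finG aG]|v]; last by case: ifPn => [_|/sF/aF/ltW//]; exact: ltW.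
exists (F `|` G); first by rewrite finite_setU.
move=> v /not_orP[nF nG]; case: ifPn => _; last exact: aG.
by rewrite (le_lt_trans (a0 v))// aG.
Qed.

Lemma lball_finite M a s : (forall v, 0 <= a v) -> uniq s ->
  (forall v, v \notin s -> a v = 0) ->
  match X return Prop with
  | ell p => \sum_(v <- s) a v `^ p <= M `^ p
  | c_zero => 0 <= M /\ {in s, forall v, a v <= M}
  end -> lball M a.
Proof.
move=> a0 us as0; rewrite /lball /lspace.
move: X_ok; case: X => [p /= p1 sM t ut|_ [M0 aM]].
  apply: le_trans sM; have p0 : 0 < p by exact: lt_le_trans p1.
  have -> : \sum_(v <- t) a v `^ p = \sum_(v <- [seq v <- t | v \in s]) a v `^ p.
    rewrite big_filter [RHS]big_mkcond/=; apply: eq_bigr => v _.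
    by case: ifPn => // /as0 ->; rewrite powR0// gt_eqF.
  (* Up to order, [s] consists of the entries of [t] lying in [s], followed by the entries of [s]
     that [t] misses; the latter only increase the sum. *)
  have ps : perm_eq ([seq v <- t | v \in s] ++ [seq v <- s | v \notin t]) s.
    apply: uniq_perm => //; last first.
      move=> v; rewrite mem_cat !mem_filter.
      by case: (v \in s); case: (v \in t).
    rewrite cat_uniq !filter_uniq// andbT/=.
    by apply/hasPn => v; rewrite !mem_filter => /andP[/negbTE ->]; rewrite andbF.
  by rewrite -(perm_big _ ps) big_cat lerDl sumr_ge0// => v _; exact: powR_ge0.
split=> [e e0|v].
  exists [set` s] => [|v /= /negP/as0 ->//]; exact: finite_seq.
by have [/aM//|/as0 ->] := boolP (v \in s).
Qed.

Lemma lspace_finite a s : (forall v, 0 <= a v) -> uniq s ->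
  (forall v, v \notin s -> a v = 0) -> lspace a.
Proof.
move=> a0 us as0.
(* Any finite bound will do: for [c_zero] the sum of the values replaces their maximum. *)
pose M := if X is ell p then (\sum_(v <- s) a v `^ p) `^ p^-1 else \sum_(v <- s) a v.
apply: (@lball_lspace M) => //; apply: (lball_finite a0 us as0).
rewrite /M; move: X_ok; case: X => [p /= p1|_].
  have p0 : 0 < p by exact: lt_le_trans p1.
  rewrite -powRrM mulVf ?gt_eqF// powRr1// sumr_ge0// => v _; exact: powR_ge0.
split=> [|v vs]; first by rewrite sumr_ge0.
by rewrite (perm_big _ (perm_to_rem vs)) big_cons lerDl sumr_ge0.
Qed.

End SequenceNorm.

(** * Duality *)

Section Duality.
Context {R : realType} {V : choiceType}.
Variables (X : seq_space R) (w : V -> R) (T : set V).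
Hypothesis X_ok : exponent_ok X.
Hypothesis w_gt0 : forall v, 0 < w v.
Implicit Types (a b : V -> R) (M N : R) (s : seq V).

(** The norm of the functional summing over [T], on the space with weight [w]. It is
    [inverse_weight_size] with the tree forgotten. *)
Definition dual_size : \bar R :=
  match X with
  | ell p =>
      if p == 1 then ereal_sup (0%E |` [set ((w u)^-1)%:E | u in T])
      else
        let q := p / (p - 1) in
        ((\esum_(u in T) ((w u `^ q)^-1)%:E) `^ q^-1)%E
  | c_zero => (\esum_(u in T) ((w u)^-1)%:E)%E
  end.

(** Moves the q-th root to the other side in the extended reals, so that an infinite sum is covered
    as well. *)
Lemma poweR_inv_le (x : \bar R) N q : (0 <= x)%E -> 0 <= N -> 0 < q ->
  ((x `^ q^-1)%E <= N%:E)%E = (x <= (N `^ q)%:E)%E.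
Proof.
move=> x0 N0 q0; apply/idP/idP => [h|h].
  have -> : x = ((x `^ q^-1) `^ q)%E by rewrite -poweRrM mulVf ?gt_eqF// poweRe1.
  rewrite -poweR_EFin; apply: gt0_ler_poweR; rewrite ?in_itv/= ?leey ?andbT//.
  - exact: ltW.
  - exact: poweR_ge0.
have -> : N%:E = ((N `^ q)%:E `^ q^-1)%E.
  by rewrite poweR_EFin -powRrM mulfV ?gt_eqF// powRr1.
apply: gt0_ler_poweR; rewrite ?in_itv/= ?leey ?andbT//.
- by rewrite invr_ge0 ltW.
- by rewrite lee_fin powR_ge0.
Qed.

Lemma conjugate_exponent (p : R) : 1 < p ->
  [/\ 0 < p / (p - 1), p^-1 + (p / (p - 1))^-1 = 1 &
      p / (p / (p - 1)) = p - 1].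
Proof.
move=> p1; have p0 : 0 < p by apply: lt_trans p1.
have pB1 : 0 < p - 1 by rewrite subr_gt0.
split; first exact: divr_gt0.
- by field; rewrite !gt_eqF.
- by field; rewrite !gt_eqF.
Qed.

(** Hölder's inequality for the factors [a v * w v] and [(w v)^-1], with exponents (1, ∞), (p, q) or
    (∞, 1) according to the space. *)
Lemma dual_size_bound N M a s : 0 < N -> 0 < M -> (forall v, 0 <= a v) ->
  (dual_size <= N%:E)%E -> uniq s -> {in s, forall v, T v} ->
  lball X M (fun u => a u * w u) -> \sum_(v <- s) a v <= N * M.
Proof.
move=> N0 M0 a0; rewrite /dual_size /lball.
have aE v : a v = a v * w v * (w v)^-1 by rewrite mulfK ?gt_eqF.
have aw0 v : 0 <= a v * w v by rewrite mulr_ge0// ltW.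
move: X_ok; case: X => [p /= p1|_].
  case: eqP => [->|/eqP pn1] sN us sT aM.
    apply: (@le_trans _ _ (\sum_(v <- s) N * (a v * w v))).
      rewrite big_seq [leRHS]big_seq; apply: ler_sum => v vs.
      rewrite [leLHS]aE mulrC ler_wpM2r// -lee_fin (le_trans _ sN)//.
      by apply: ereal_sup_ubound; right; exists v => //; exact: sT.
    rewrite -mulr_sumr ler_wpM2l ?(ltW N0)//.
    by have := aM _ us; rewrite powRr1 ?(ltW M0)//; under eq_bigr do rewrite powRr1//.
  have {}p1 : 1 < p by rewrite lt_neqAle eq_sym pn1.
  have [q0 pq _] := conjugate_exponent p1; set q := p / (p - 1) in sN q0 pq.
  have wq0 v : 0 <= (w v `^ q)^-1 by rewrite invr_ge0 powR_ge0.
  under eq_bigr do rewrite aE; rewrite mulrC.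
  apply: (hoelder_seq (p := p) (q := q)) => //.
  - by apply: lt_trans p1.
  - by move=> v; rewrite invr_ge0 ltW.
  - exact: aM.
  under eq_bigr => v _ do rewrite -(powR_inv1 (ltW (w_gt0 v))) powRAC powR_inv1 ?powR_ge0//.
  rewrite -lee_fin (le_trans (sum_le_esum wq0 us sT))//.
  by rewrite -poweR_inv_le ?(ltW N0)//; apply: esum_ge0 => v _; rewrite lee_fin.
move=> sN us sT [_ aM].
have w0 v : 0 <= (w v)^-1 by rewrite invr_ge0 ltW.
apply: (@le_trans _ _ (\sum_(v <- s) M * (w v)^-1)).
  by apply: ler_sum => v _; rewrite [leLHS]aE ler_wpM2r.
rewrite -mulr_sumr mulrC ler_wpM2r ?(ltW M0)//.
by rewrite -lee_fin (le_trans (sum_le_esum w0 us sT)).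
Qed.

(* In the case 1 < p the witness is the equality case of Hölder's inequality,
   c u = (w u)^-q / D with D = \sum_(u <- s) (w u)^-q. *)
Lemma dual_size_attained N : 0 <= N -> (N%:E < dual_size)%E ->
  exists s (c : V -> R) M,
    [/\ uniq s, {in s, forall v, T v}, forall v, 0 <= c v,
        forall v, v \notin s -> c v = 0 &
        [/\ \sum_(v <- s) c v = 1, 0 <= M, N * M < 1 &
            lball X M (fun u => c u * w u)]].
Proof.
move=> N0; rewrite /dual_size.
(* Only the finite list [s], unnormalised coefficients [d] and the norm bound [M] depend on the
   space; dividing [d] by its sum and extending by 0 is common to all three cases. *)
suff finite_case s (d : V -> R) : uniq s -> {in s, forall v, T v} ->
    (forall v, 0 <= d v) -> 0 < \sum_(v <- s) d v -> forall M,
    0 <= M -> N * M < 1 ->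
    match X return Prop with
    | ell p => \sum_(v <- s) (d v / (\sum_(v <- s) d v) * w v) `^ p <= M `^ p
    | c_zero => {in s, forall v, d v / (\sum_(v <- s) d v) * w v <= M}
    end -> exists s (c : V -> R) M,
    [/\ uniq s, {in s, forall v, T v}, forall v, 0 <= c v,
        forall v, v \notin s -> c v = 0 &
        [/\ \sum_(v <- s) c v = 1, 0 <= M, N * M < 1 &
            lball X M (fun u => c u * w u)]].
  move: finite_case; move: X_ok; case: X => [p /= p1|_] fin.
    case: eqP => [_|/eqP pn1] sN.
      have [_ [->|[u Tu <-]]] := ereal_sup_gt sN.
        by rewrite lte_fin ltNge N0.
      (* For p = 1 a single vertex [u] with [(w u)^-1] above [N] suffices, and its basis vector has
         norm [w u]. *)
      rewrite lte_fin => Nu; apply: (fin [:: u] (fun=> 1) _ _ _ _ (w u)) => //.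
      - by move=> v; rewrite inE => /eqP ->.
      - by rewrite big_seq1.
      - exact: ltW.
      - by rewrite -ltr_pdivlMr// mul1r.
      - by rewrite !big_seq1 divr1 mul1r.
    have {}p1 : 1 < p by rewrite lt_neqAle eq_sym pn1.
    have p0 : 0 < p by apply: lt_trans p1.
    have [q0 pq pq'] := conjugate_exponent p1; set q := p / (p - 1) in sN q0 pq pq'.
    have wq0 v : 0 <= (w v `^ q)^-1 by rewrite invr_ge0 powR_ge0.
    have : ((N `^ q)%:E < \esum_(u in T) ((w u `^ q)^-1)%:E)%E.
      rewrite ltNge -poweR_inv_le// -?ltNge//; apply: esum_ge0 => v _.
      by rewrite lee_fin.
    move=> /(lt_esum wq0)[s [us sT]]; set D := \sum_(v <- s) _ => ND.
    have D0 : 0 < D by rewrite (le_lt_trans _ ND)// powR_ge0.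
    (* The extremal vector has norm D^(-1/q), so that N M < 1 amounts to N^q < D. *)
    apply: (fin s (fun v => (w v `^ q)^-1) us sT wq0 D0 (D `^ (- q^-1))).
    - exact: powR_ge0.
    - rewrite powRN ltr_pdivrMr ?powR_gt0// mul1r.
      have -> : N = (N `^ q) `^ q^-1 by rewrite -powRrM mulfV ?gt_eqF// powRr1.
      by apply: gt0_ltr_powR; rewrite ?nnegrE ?invr_gt0 ?powR_ge0 ?(ltW D0).
    (* Since (1 - q) p = -q, each p-th power is (w v)^(-q) D^(-p). The sum is therefore D^(1 - p),
       which equals M^p because p / q = p - 1. *)
    rewrite -/D (eq_bigr (fun v => (w v `^ q)^-1 * (D `^ p)^-1)) => [|v _].
      rewrite -mulr_suml -/D -powRrM -powRN.
      rewrite -{1}(powRr1 (ltW D0)) -powRD; last by rewrite (gt_eqF D0) implybT.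
      by rewrite mulNr [q^-1 * p]mulrC pq' opprB.
    rewrite -mulrA [_^-1 * w v]mulrC mulrA powR_div ?mulr_ge0 ?(ltW (w_gt0 v))//.
    congr (_ / _).
    rewrite -powRN -{2}(powRr1 (ltW (w_gt0 v))) -powRD; last by rewrite (gt_eqF (w_gt0 v)) implybT.
    rewrite -powRrM; congr (_ `^ _); move: pq; rewrite /q => _.
    have pB1 : 0 < p - 1 by rewrite subr_gt0.
    by field; rewrite gt_eqF.
  have w0 v : 0 <= (w v)^-1 by rewrite invr_ge0 ltW.
  move=> /(lt_esum w0)[s [us sT]]; set D := \sum_(v <- s) _ => ND.
  have D0 : 0 < D by rewrite (le_lt_trans _ ND).
  (* For [c_zero] the extremal vector has constant weighted modulus 1 / D on [s]. *)
  apply: (fin s (fun v => (w v)^-1) us sT w0 D0 D^-1).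
  - by rewrite invr_ge0 ltW.
  - by rewrite ltr_pdivrMr// mul1r.
  by move=> v _; rewrite mulrAC mulVf ?gt_eqF// mul1r.
move=> us sT d0; set D := \sum_(v <- s) d v => D0 M M0 NM HM.
pose c v := if v \in s then d v / D else 0.
have c0 v : 0 <= c v by rewrite /c; case: ifP => // _; rewrite divr_ge0// ltW.
have cw0 v : 0 <= c v * w v by rewrite mulr_ge0// ltW.
exists s, c, M; split=> //.
  by move=> v /negbTE vs; rewrite /c vs.
split=> //.
  rewrite big_seq (eq_bigr (fun v => d v / D)) => [|v vs]; last by rewrite /c vs.
  by rewrite -big_seq -mulr_suml mulfV ?gt_eqF.
apply: (lball_finite X_ok cw0 us) => [v /negbTE vs|].
  by rewrite /c vs mul0r.
move: HM; case: X => [p|].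
  rewrite big_seq => HM; rewrite big_seq; apply: le_trans HM.
  by apply: ler_sum => v vs; rewrite /c vs.
by move=> HM; split=> // v vs; rewrite /c vs; exact: HM.
Qed.

End Duality.

(** * Descendants in a rooted tree *)

Section Descendants.
Context {V : countType}.
Variable E : rel V.
Hypothesis E_tree : directed_tree E.

Lemma Chin_add m n u v w : Chin E m u v -> Chin E n v w -> Chin E (m + n) u w.
Proof.
elim: m u => [|m IH] u /=; first by move=> ->.
by move=> [x ux xv] vw; exists x => //; exact: IH.
Qed.

Lemma Chin_split m n u w : Chin E (m + n) u w ->
  exists2 v, Chin E m u v & Chin E n v w.
Proof.
elim: m u => [|m IH] u /=; first by exists u.
by move=> [x ux /IH[v xv vw]]; exists v => //; exists x.
Qed.

Lemma Chin1 u v : Chin E 1 u v <-> E u v.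
Proof. by split=> [[x ux ->]//|uv]; exists v. Qed.

Lemma Chin_ancestor_unique n u u' v : Chin E n u v -> Chin E n u' v -> u = u'.
Proof.
elim: n u u' => [|n IH] u u' /=; first by move=> -> ->.
move=> [x ux xv] [x' ux' xv']; move: ux'; rewrite -(IH _ _ xv xv') => ux'.
exact: tree_parent_unique E_tree _ _ _ ux ux'.
Qed.

(** Induction along an undirected path from the root: an edge downwards adds one to the depth; an
    edge upwards leads to the unique parent and removes one, which cannot happen at the root. *)
Lemma Chin_root r v : tree_root E r -> exists n, Chin E n r v.
Proof.
move=> rE; have [->|rv] := eqVneq r v; first by exists 0.
have [s [+ sv]] := tree_connected E_tree rv; rewrite -{}sv {v rv}.
elim/last_ind: s => [|s y IH]; first by exists 0.
rewrite rcons_path last_rcons => /andP[/IH[n rn] /orP[ly|yl]].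
  by exists (n + 1)%N; apply: Chin_add rn _; exact/Chin1.
case: n rn => [rl|n]; first by move: yl; rewrite rl (negbTE (rE y)).
rewrite -addn1 => /Chin_split[z rz /Chin1 zl].
by exists n; rewrite (tree_parent_unique E_tree yl zl).
Qed.

(** If [u] has depth [m], an ancestor more than [m] generations back would be a proper ancestor of
    the root. *)
Lemma Chin_bounded_depth r u : tree_root E r ->
  exists n0, forall n v, (n0 <= n)%N -> ~ Chin E n v u.
Proof.
move=> rE; have [m rm] := Chin_root u rE; exists m.+1 => n v mn.
rewrite -(subnK (ltnW mn)) => /Chin_split[w vw wu].
rewrite -(Chin_ancestor_unique rm wu) in vw.
move: vw; rewrite -(subnSK mn) -addn1 => /Chin_split[x _ /Chin1].
by rewrite (negbTE (rE x)).
Qed.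

End Descendants.

(** * The weighted space *)

Section Norm.
Context {R : realType} {k : scalar_kind} {V : countType}.
Local Notation K := (scalar_field R k).
Variables (X : seq_space R) (mu : V -> K).
Hypothesis X_ok : exponent_ok X.
Hypothesis mu_neq0 : forall v, mu v != 0.
Implicit Types (f g : V -> K) (a : K) (e M : R) (s : seq V).

Local Notation wsp := (wspace X mu).
Local Notation nrm := (space_norm X mu).

Definition weighted f : V -> R := fun v => modulus (f v * mu v).
Definition lin a f g : V -> K := fun v => a * f v + g v.
Definition delta u : V -> K := fun v => (v == u)%:R.
(** Written as a combination of basis vectors so that induction on [s] carries linear maps through
    it; without repetitions in [s] it is the truncation of [f] to [s]. *)
Definition comb s f : V -> K := fun v => \sum_(u <- s) f u * delta u v.

Lemma weighted_ge0 f v : 0 <= weighted f v.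
Proof. exact: modulus_ge0. Qed.
Hint Resolve weighted_ge0 : core.

Lemma wspaceE f : wsp f = lspace X (weighted f).
Proof. by rewrite /wspace /lspace; case: X. Qed.

Lemma space_normE f : nrm f = lnorm X (weighted f).
Proof. by rewrite /space_norm /lnorm; case: X. Qed.

Lemma space_norm_ge0 f : 0 <= nrm f.
Proof. by rewrite space_normE lnorm_ge0. Qed.

Lemma lball_space_norm f : wsp f -> lball X (nrm f) (weighted f).
Proof. by rewrite wspaceE space_normE => /(lball_lnorm X_ok); exact. Qed.

Lemma wspace_lball M f : 0 <= M -> lball X M (weighted f) -> wsp f /\ nrm f <= M.
Proof.
move=> M0 fM; rewrite wspaceE space_normE.
by split; [exact: lball_lspace fM|exact: lnorm_le].
Qed.

(** The slack [e] provides the positive radius that [lballD] and [dual_size_bound] demand, even when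
    the norm is 0. *)
Lemma lball_space_norm_add e f : 0 <= e -> wsp f -> lball X (nrm f + e) (weighted f).
Proof.
move=> e0 /lball_space_norm; apply: lball_monoR => //; first exact: space_norm_ge0.
by rewrite lerDl.
Qed.

Lemma modulus_eval f v : wsp f -> modulus (f v) <= (modulus (mu v))^-1 * nrm f.
Proof.
move=> /lball_space_norm fM; rewrite mulrC ler_pdivlMr ?modulus_gt0// -modulusM.
exact: (lball_eval X_ok v (weighted_ge0 f) (space_norm_ge0 f) fM).
Qed.

Lemma wspaceD f g : wsp f -> wsp g ->
  wsp (fun v => f v + g v) /\ nrm (fun v => f v + g v) <= nrm f + nrm g.
Proof.
move=> wf wg.
have H e : 0 < e -> wsp (fun v => f v + g v) /\
    nrm (fun v => f v + g v) <= (nrm f + e / 2) + (nrm g + e / 2).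
  move=> e0; have e20 : 0 < e / 2 by rewrite divr_gt0.
  have fe : 0 < nrm f + e / 2 by rewrite ltr_wpDl// space_norm_ge0.
  have ge : 0 < nrm g + e / 2 by rewrite ltr_wpDl// space_norm_ge0.
  apply: wspace_lball; first by rewrite addr_ge0 ?(ltW fe) ?(ltW ge).
  apply: lball_le (lballD X_ok _ _ fe ge (lball_space_norm_add (ltW e20) wf)
    (lball_space_norm_add (ltW e20) wg)) => // v.
  by rewrite /weighted mulrDl ler_modulusD.
split; first by have [] := H _ ltr01.
apply/ler_addgt0Pr => e e0; have [_ /le_trans->//] := H _ e0.
by rewrite addrACA -splitr.
Qed.

Lemma wspace0 : wsp (fun=> 0) /\ nrm (fun=> 0) <= 0.
Proof.
apply: wspace_lball => //; apply: (@lball_finite _ _ _ X_ok _ _ [::]) => //.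
  by move=> v _; rewrite /weighted mul0r modulus0.
by case: X => // p; rewrite big_nil powR_ge0.
Qed.

Lemma wspaceZ a f : wsp f ->
  wsp (fun v => a * f v) /\ nrm (fun v => a * f v) <= modulus a * nrm f.
Proof.
move=> wf; have [->|a0] := eqVneq a 0.
  rewrite (_ : (fun _ => _) = fun=> 0); last by apply/funext => v; rewrite mul0r.
  by rewrite modulus0 mul0r; exact: wspace0.
apply: wspace_lball; first by rewrite mulr_ge0 ?modulus_ge0 ?space_norm_ge0.
apply: lball_le (lballZ X_ok _ (modulus_gt0 a0) (space_norm_ge0 _)
  (lball_space_norm wf)) => // v.
by rewrite /weighted -mulrA modulusM.
Qed.

Lemma wspace_lin a f g : wsp f -> wsp g -> wsp (lin a f g).
Proof.
by move=> wf wg; apply: (wspaceD _ wg).1; exact: (wspaceZ a wf).1.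
Qed.

Lemma space_norm_lin a f g : wsp f -> wsp g ->
  nrm (lin a f g) <= modulus a * nrm f + nrm g.
Proof.
move=> wf wg; have [waf naf] := wspaceZ a wf.
by rewrite (le_trans (wspaceD waf wg).2)// lerD2r.
Qed.

Lemma sub_lin f g : f \- g = lin (-1) g f.
Proof. by apply/funext => v; rewrite /lin /= mulN1r addrC. Qed.

Lemma wspaceB f g : wsp f -> wsp g -> wsp (f \- g).
Proof. by move=> wf wg; rewrite sub_lin; exact: wspace_lin. Qed.

Lemma space_normC f g : wsp f -> wsp g -> nrm (f \- g) <= nrm (g \- f).
Proof.
move=> wf wg; have -> : f \- g = lin (-1) (g \- f) (fun=> 0).
  by apply/funext => v; rewrite /lin /= mulN1r opprB addr0.
rewrite (le_trans (space_norm_lin _ (wspaceB wg wf) wspace0.1))//.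
by rewrite modulusN modulus1 mul1r gerDl wspace0.2.
Qed.

Lemma space_norm_triangle f g h : wsp f -> wsp g -> wsp h ->
  nrm (f \- h) <= nrm (f \- g) + nrm (g \- h).
Proof.
move=> wf wg wh; have -> : f \- h = lin 1 (f \- g) (g \- h).
  by apply/funext => v; rewrite /lin /= mul1r addrA subrK.
by rewrite (le_trans (space_norm_lin _ (wspaceB wf wg) (wspaceB wg wh)))// modulus1 mul1r.
Qed.

(** * Finitely supported vectors and their density *)

Lemma combE s f v : uniq s -> comb s f v = if v \in s then f v else 0.
Proof.
move=> us; rewrite /comb; case: ifPn => [vs|vs].
  rewrite (bigD1_seq v)//= /delta eqxx mulr1 big1 ?addr0// => u /negbTE uv.
  by rewrite eq_sym uv mulr0.
rewrite big_seq big1// => u us'; rewrite /delta; case: eqP => [vu|]; last by rewrite mulr0.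
by rewrite vu us' in vs.
Qed.

Lemma comb_cons u s f : comb (u :: s) f = lin (f u) (delta u) (comb s f).
Proof. by apply/funext => v; rewrite /comb big_cons. Qed.

Lemma wspace_delta u : wsp (delta u).
Proof.
rewrite wspaceE; apply: (@lspace_finite _ _ _ X_ok _ [:: u]) => // v.
by rewrite inE /weighted /delta => /negbTE ->; rewrite mul0r modulus0.
Qed.

Lemma wspace_comb s f : wsp (comb s f).
Proof.
elim: s => [|u s IH]; last by rewrite comb_cons; apply: wspace_lin => //; exact: wspace_delta.
rewrite (_ : comb _ _ = fun=> 0); first exact: wspace0.1.
by apply/funext => v; rewrite /comb big_nil.
Qed.

Lemma space_norm_delta_gt0 u : 0 < nrm (delta u).
Proof.
have := modulus_eval u (wspace_delta u); rewrite /delta eqxx modulus1 => h.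
rewrite lt_neqAle space_norm_ge0 andbT eq_sym; apply: contraTneq h => ->.
by rewrite mulr0 -ltNge.
Qed.

(** Enlarging the support by a prescribed vertex [u] only shrinks the error. *)
Lemma comb_dense u f e : wsp f -> 0 < e ->
  exists s, [/\ uniq s, u \in s & nrm (f \- comb s f) <= e].
Proof.
rewrite wspaceE => wf e0.
have [s us sE] := lball_tail X_ok (weighted_ge0 f) wf e0.
exists (undup (u :: s)); split; [exact: undup_uniq|by rewrite mem_undup mem_head|].
apply: (wspace_lball (ltW e0) _).2.
apply: lball_le sE => // v.
rewrite /weighted -[(f \- _) v]/(f v - comb _ f v) combE ?undup_uniq//.
rewrite mem_undup inE.
case: ifPn => [_|/norP[_ /negbTE ->]]; last by rewrite subr0.
by rewrite subrr mul0r modulus0; case: ifP => // _; exact: modulus_ge0.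
Qed.

(** * Norm-open and weakly open sets *)

Lemma norm_open_ball f e : wsp f ->
  norm_open X mu [set g | wsp g /\ nrm (g \- f) < e].
Proof.
move=> wf; split=> [g []//|g [wg ge]]; exists (e - nrm (g \- f)).
  by rewrite subr_gt0.
move=> h wh; rewrite ltrBrDr => hg; split=> //.
exact: le_lt_trans (space_norm_triangle wh wg wf) hg.
Qed.

Lemma dual_functional_eval u : dual_functional X mu (fun f => f u).
Proof.
split=> //; exists (modulus (mu u))^-1 => f; exact: modulus_eval.
Qed.

Lemma seq_lower_bound (I : eqType) (s : seq I) (d : I -> R) :
  (forall i, i \in s -> 0 < d i) ->
  exists2 e, 0 < e & forall i, i \in s -> e <= d i.
Proof.
elim: s => [|i s IH] d0; first by exists 1.
have [j js|e e0 es] := IH; first by rewrite d0// inE js orbT.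
exists (Num.min (d i) e); first by rewrite lt_min e0 d0// mem_head.
by move=> j; rewrite inE ge_min => /predU1P[->|/es ->]; rewrite ?lexx ?orbT.
Qed.

Lemma weakly_open_box s a e :
  weakly_open X mu [set f | wsp f /\ forall v, v \in s -> modulus (f v - a) < e].
Proof.
split=> [f []//|f [wf fe]].
(* [d] is a common lower bound for the margins left at the finitely many coordinates. *)
have [|d d0 ds] := @seq_lower_bound _ s (fun v => e - modulus (f v - a)).
  by move=> v /fe; rewrite subr_gt0.
exists (size s), (fun i g => g (tnth (in_tuple s) i)), d; split=> //.
  by move=> i; exact: dual_functional_eval.
move=> g wg gf; split=> // v vs.
have vi : (index v s < size s)%N by rewrite index_mem.
have := gf (Ordinal vi); rewrite (tnth_nth v) /= nth_index// => gfv.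
have -> : g v - a = (g v - f v) + (f v - a) by rewrite addrA subrK.
rewrite (le_lt_trans (ler_modulusD _ _))// -ltrBrDr.
exact: lt_le_trans gfv (ds _ vs).
Qed.

Lemma weakly_open_norm_open W : weakly_open X mu W -> norm_open X mu W.
Proof.
move=> [Wsp Wo]; split=> // f Wf; have wf := Wsp _ Wf.
have [m [phi [e [phiD e0 We]]]] := Wo f Wf.
have [M HM] := choice (fun i => (phiD i).2).
(* One constant dominating all the bounds [M i], and positive even when there are no functionals. *)
pose b := 1 + \sum_i `|M i|.
have b0 : 0 < b by rewrite ltr_pwDl// sumr_ge0.
exists (e / b); first exact: divr_gt0.
move=> g wg gf; apply: We => // i.
have -> : phi i g - phi i f = phi i (g \- f).
  apply/eqP; rewrite subr_eq -[phi i (g \- f)]mul1r -(phiD i).1//; last exact: wspaceB.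
  by apply/eqP; congr (phi i); apply/funext => v; rewrite /= mul1r subrK.
apply: le_lt_trans (HM i _ (wspaceB wg wf)) _.
rewrite ltr_pdivlMr// mulrC in gf; apply: le_lt_trans gf.
rewrite ler_wpM2r ?space_norm_ge0// (le_trans (ler_norm _))//.
by rewrite /b (bigD1 i)//= addrCA lerDl addr_ge0// sumr_ge0.
Qed.

End Norm.

(** * The backward shift *)

Section Shift.
Context {R : realType} {k : scalar_kind} {V : countType}.
Local Notation K := (scalar_field R k).
Variables (E : rel V) (X : seq_space R) (mu : V -> K) (r : V) (b : R).
Local Notation wsp := (wspace X mu).
Local Notation nrm := (space_norm X mu).
Local Notation B := (@backward_shift R k V E).
Hypothesis E_tree : directed_tree E.
Hypothesis r_root : tree_root E r.
Hypothesis X_ok : exponent_ok X.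
Hypothesis mu_neq0 : forall v, mu v != 0.
Hypothesis B_cvg : forall f : V -> K, wsp f ->
  forall v, cvg (partial_sum (child_terms E f v) @ totally).
Hypothesis B_wsp : forall f, wsp f -> wsp (B f).
Hypothesis b_ge1 : 1 <= b.
Hypothesis B_le : forall f, wsp f -> nrm (B f) <= b * nrm f.
Implicit Types (f g : V -> K) (a : K) (s : seq V) (u v w : V).

Let b_ge0 : 0 <= b := le_trans ler01 b_ge1.

Lemma shift_lin a f g : wsp f -> wsp g -> B (lin a f g) = lin a (B f) (B g).
Proof.
move=> wf wg; apply/funext => v; rewrite /lin /backward_shift.
have := sum_linear a (@B_cvg f wf v) (@B_cvg g wg v) => <-.
congr sum; apply/funext => u; rewrite /child_terms.
by case: ifP => // _; rewrite mulr0 addr0.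
Qed.

Lemma shift_delta u : B (delta u) = fun v => (E v u)%:R.
Proof.
apply/funext => v; rewrite /backward_shift.
have := @sum_at K V (child_terms E (delta u) v) u => ->.
  by rewrite /child_terms /delta eqxx; case: (E v u).
by move=> w /negbTE wu; rewrite /child_terms /delta wu; case: ifP.
Qed.

Lemma lin0 : lin (-1) (fun=> 0) (fun=> 0) = (fun=> 0) :> (V -> K).
Proof. by apply/funext => v; rewrite /lin mulr0 addr0. Qed.

Lemma wspace_iter_shift n f : wsp f -> wsp (iter n B f).
Proof. by move=> wf; elim: n => // n IH; exact: B_wsp. Qed.

Lemma iter_shift_lin n a f g : wsp f -> wsp g ->
  iter n B (lin a f g) = lin a (iter n B f) (iter n B g).
Proof.
move=> wf wg; elim: n => // n IH.
by rewrite !iterS IH shift_lin//; exact: wspace_iter_shift.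
Qed.

Lemma iter_shift0 n : iter n B (fun=> 0) = fun=> 0.
Proof.
have w0 : wsp (fun=> 0) by exact: (wspace0 _ X_ok).1.
elim: n => // n IH; rewrite iterS IH.
rewrite -[in LHS]lin0 shift_lin//; apply/funext => v.
by rewrite /lin mulN1r addNr.
Qed.

Lemma space_norm_iter_shift n f : wsp f -> nrm (iter n B f) <= b ^+ n * nrm f.
Proof.
move=> wf; elim: n => [|n IH]; first by rewrite expr0 mul1r.
rewrite iterS (le_trans (B_le (wspace_iter_shift _ wf)))// exprS -mulrA.
by rewrite ler_wpM2l.
Qed.

(** The shift sends [delta u] to the basis vector of the parent of [u], or to 0 at the root. The
    iterate is thus the indicator of the n-th ancestor. *)
Lemma iter_shift_delta n u : iter n B (delta u) = fun v => (`[< Chin E n v u >])%:R.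
Proof.
elim: n u => [|n IH] u; apply/funext => v.
  rewrite /= /delta; congr (nat_of_bool _)%:R.
  by apply/eqP/asboolP => [->|->].
rewrite iterSr shift_delta; have [[w wu]|noparent] := pselect (exists w, E w u).
  have -> : (fun v => (E v u)%:R) = delta w :> (V -> K).
    apply/funext => x; rewrite /delta; congr (nat_of_bool _)%:R.
    by apply/idP/eqP => [xu|->//]; exact: (tree_parent_unique E_tree xu wu).
  rewrite IH; congr (nat_of_bool _)%:R; apply/asboolP/asboolP => [vw|].
    by rewrite -addn1; apply: Chin_add vw _; exact/Chin1.
  rewrite -addn1 => /Chin_split[x vx /Chin1 xu].
  by rewrite -(tree_parent_unique E_tree xu wu).
have -> : (fun v => (E v u)%:R) = (fun=> 0) :> (V -> K).
  apply/funext => x; case: (boolP (E x u)) => // xu.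
  by case: noparent; exists x.
rewrite iter_shift0; case: asboolP => //; rewrite -addn1 => /Chin_split[x _ /Chin1 xu].
by case: noparent; exists x.
Qed.

Lemma iter_shift_comb n s f v :
  iter n B (comb s f) v = \sum_(u <- s | `[< Chin E n v u >]) f u.
Proof.
elim: s => [|u s IH].
  rewrite big_nil (_ : comb _ _ = fun=> 0) ?iter_shift0//.
  by apply/funext => w; rewrite /comb big_nil.
rewrite comb_cons iter_shift_lin; [|exact: wspace_delta|exact: wspace_comb].
rewrite /lin IH iter_shift_delta big_cons.
by case: asboolP; rewrite ?mulr1 ?mulr0 ?add0r.
Qed.

Lemma iter_shift_comb_eventually0 s f :
  exists n0, forall n, (n0 <= n)%N -> iter n B (comb s f) = fun=> 0.
Proof.
have [d dE] := choice (fun u => Chin_bounded_depth E_tree u r_root).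
exists (\max_(u <- s) d u) => n sn; apply/funext => v.
rewrite iter_shift_comb big_seq_cond big1// => u /andP[us /asboolP]; apply: contraPeq => _.
apply: dE; apply: leq_trans sn; exact: leq_bigmax_seq.
Qed.

Lemma modulus_iter_shift_eval n f v : wsp f ->
  modulus (iter n B f v) <= (modulus (mu v))^-1 * b ^+ n * nrm f.
Proof.
move=> wf; rewrite (le_trans (modulus_eval _ _ _ (wspace_iter_shift n wf)))//.
by rewrite -mulrA ler_wpM2l ?space_norm_iter_shift// invr_ge0 modulus_ge0.
Qed.

(** * Lifts of basis vectors and the sets A(v,N) *)

(** The vector side of [A_set]. In this form, times can be moved and vertices replaced by ancestors
    simply by applying powers of [B]; [N] is real to absorb powers of [b]. *)
Definition liftable v (N : R) : set nat :=
  [set n | exists e, [/\ wsp e, iter n B e = delta v & N * nrm e < 1]].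

Lemma inverse_weight_sizeE v n :
  inverse_weight_size E X mu v n = dual_size X (fun u => modulus (mu u)) (Chin E n v).
Proof. by rewrite /inverse_weight_size /dual_size; case: X. Qed.

Let modulus_mu_gt0 v : 0 < modulus (mu v).
Proof. exact: modulus_gt0. Qed.

(** The extremal coefficients have sum 1 and live on [Chin E n v]; by uniqueness of n-th ancestors
    no other vertex sees them, so the iterate is exactly [delta v]. The sum being 1 also rules out
    an empty support. *)
Lemma A_set_liftable v (N n : nat) : A_set E X mu v N n ->
  liftable v N%:R n /\ Chin E n v !=set0.
Proof.
rewrite /A_set /= inverse_weight_sizeE.
move=> /(dual_size_attained X_ok modulus_mu_gt0 (ler0n _ N)).
move=> [s [c [M [us sT c0 cs [c1 M0 NM cM]]]]]; split; last first.
  case: s us sT cs c1 => [|u s] _ sT _ c1; last by exists u; apply: sT; exact: mem_head.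
  by move: c1; rewrite big_nil => /esym/eqP; rewrite oner_eq0.
pose e : V -> K := fun u => of_real (c u).
have eE : comb s e = e.
  apply/funext => u; rewrite combE//; case: ifPn => // /cs eu.
  by rewrite /e eu of_real0.
have [we ne] : wsp e /\ nrm e <= M.
  apply: wspace_lball => //; rewrite (_ : weighted mu e = fun u => c u * modulus (mu u))//.
  by apply/funext => u; rewrite /weighted modulusM modulus_of_real ger0_norm.
exists e; split=> //; last by rewrite (le_lt_trans _ NM)// ler_wpM2l.
apply/funext => v'; rewrite -eE iter_shift_comb /delta.
have [->|v'v] := eqVneq v' v.
  rewrite big_seq_cond (eq_bigl (fun u => u \in s)) => [|u]; last first.
    by have [/sT vu|//] := boolP (u \in s); exact/asboolP.
  by rewrite -big_seq -of_real_sum c1 of_real1.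
rewrite big_seq_cond big1// => u /andP[/sT vu /asboolP v'u].
by rewrite (Chin_ancestor_unique E_tree v'u vu) eqxx in v'v.
Qed.

(** Contrapositive, by Hölder's inequality. As [dual_size_bound] concerns finite sums, it is applied
    to a truncation of [f]; the remainder is controlled by the continuity of evaluation after
    [iter n B]. *)
Lemma A_set_of_iter v (N n : nat) f : (0 < N)%N -> wsp f ->
  N%:R * nrm f < modulus (iter n B f v) -> A_set E X mu v N n.
Proof.
move=> N0 wf; rewrite /A_set /= inverse_weight_sizeE => fN.
rewrite ltNge; apply/negP => sizeN; move: fN; rewrite ltNge => /negP; apply.
set C := (modulus (mu v))^-1 * b ^+ n.
have C0 : 0 <= C by rewrite mulr_ge0 ?exprn_ge0 ?invr_ge0 ?modulus_ge0.
have NC : 0 < N%:R + C by rewrite ltr_wpDr ?ltr0n.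
(* Enlarging the radius costs [N * d] and the remainder costs [C * d]; this [d] makes the two add up
   to [e]. *)
apply/ler_addgt0Pr => e e0; pose d := e / (N%:R + C).
have d0 : 0 < d by exact: divr_gt0.
have [s [us _ sd]] := comb_dense X_ok v wf d0.
have ws : wsp (comb s f) by exact: wspace_comb.
have fE : f = lin 1 (comb s f) (f \- comb s f).
  by apply/funext => u; rewrite /lin mul1r /= addrC subrK.
rewrite [X in iter n B X]fE iter_shift_lin//; last exact: wspaceB.
rewrite /lin mul1r; apply: le_trans (ler_modulusD _ _) _.
have -> : N%:R * nrm f + e = N%:R * (nrm f + d) + C * d.
  by rewrite mulrDr -addrA -mulrDl /d [_ * (e / _)]mulrC divfK// gt_eqF.
apply: lerD.
  rewrite iter_shift_comb (le_trans (ler_modulus_sum _ _ _))// -big_filter.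
  apply: (dual_size_bound X_ok modulus_mu_gt0 _ _ _ sizeN).
  - by rewrite ltr0n.
  - by rewrite ltr_wpDl// space_norm_ge0.
  - by move=> u; exact: modulus_ge0.
  - exact: filter_uniq.
  - by move=> u; rewrite mem_filter => /andP[/asboolP].
  have := lball_space_norm_add X_ok (ltW d0) wf.
  rewrite (_ : weighted mu f = fun u => modulus (f u) * modulus (mu u))//.
  by apply/funext => u; rewrite /weighted modulusM.
rewrite (le_trans (modulus_iter_shift_eval _ _ (wspaceB X_ok wf ws)))//.
by rewrite ler_wpM2l.
Qed.

(** Evaluating a lift [e] at [v] gives 1 ≤ |mu v|^-1 b^n ||e||. For n ≤ n0 the right side is at most
    N ||e|| < 1, since powers of [b] increase. *)
Lemma liftable_gt v (N : R) n0 n : (modulus (mu v))^-1 * b ^+ n0 <= N ->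
  liftable v N n -> (n0 < n)%N.
Proof.
move=> CN [e [we ne Ne]]; rewrite ltnNge; apply/negP => nn0.
have := modulus_iter_shift_eval n v we; rewrite ne /delta eqxx modulus1 leNgt => /negP; apply.
apply: le_lt_trans Ne; rewrite ler_wpM2r ?space_norm_ge0//.
apply: le_trans CN; rewrite ler_wpM2l ?invr_ge0 ?modulus_ge0//.
exact: ler_weXn2l.
Qed.

(** If [e] lifts [delta w] at time n, then B^(n + M) e = B^M delta_w = delta_v, so B^(n + M - m) e
    lifts [delta v] at time m. The exponent lies between 0 and 2M, whence the factor in [N']. *)
Lemma liftable_near v w (M n m : nat) (N N' : R) : 0 <= N -> Chin E M v w ->
  (m <= n + M)%N -> (n <= m + M)%N -> N * b ^+ (M + M) <= N' ->
  liftable w N' n -> liftable v N m.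
Proof.
move=> N0 vw mn nm NN' [e [we ne Ne]].
exists (iter (n + M - m) B e); split; first exact: wspace_iter_shift.
  rewrite -iterD subnKC// addnC iterD ne iter_shift_delta; apply/funext => x.
  rewrite /delta; congr (nat_of_bool _)%:R; apply/asboolP/eqP => [xw|->//].
  exact: (Chin_ancestor_unique E_tree xw vw).
apply: le_lt_trans Ne; apply: le_trans (_ : N * (b ^+ (M + M) * nrm e) <= _).
  rewrite ler_wpM2l// (le_trans (space_norm_iter_shift _ we))//.
  rewrite ler_wpM2r ?space_norm_ge0// ler_weXn2l//.
  by rewrite leq_subLR addnA leq_add2r.
by rewrite mulrA ler_wpM2r ?space_norm_ge0.
Qed.

(** Superposition of lifts of the basis vectors, with coefficients [f v]. *)
Lemma liftable_comb s f (N : R) n : 0 <= N ->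
  (forall v, v \in s -> liftable v N n) ->
  exists g, [/\ wsp g, iter n B g = comb s f &
                N * nrm g <= \sum_(v <- s) modulus (f v)].
Proof.
move=> N0; elim: s => [|v s IH] sN.
  have [w0 n0] := wspace0 mu X_ok.
  exists (fun=> 0); split=> //.
    by rewrite iter_shift0; apply/funext => u; rewrite /comb big_nil.
  by rewrite big_nil mulr_ge0_le0.
have [e [we ne Ne]] := sN v (mem_head _ _).
have [u us|g [wg ng Ng]] := IH; first by apply: sN; rewrite inE us orbT.
exists (lin (f v) e g); split; first exact: wspace_lin.
  by rewrite iter_shift_lin// ne ng comb_cons.
rewrite big_cons (le_trans (ler_wpM2l N0 (space_norm_lin X_ok _ we wg)))//.
rewrite mulrDr lerD// mulrCA -[leRHS]mulr1 ler_wpM2l ?modulus_ge0//.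
exact: ltW.
Qed.

(** * The implications between the conditions *)

Section Transitivity.
Variable F : set (set nat).
Hypothesis F_furstenberg : furstenberg_family F.

Definition large_A_sets := forall (N : nat) (S : set V), (0 < N)%N ->
  finite_set S -> F (\bigcap_(v in S) A_set E X mu v N).

(** Members of [F] are infinite, so some A(v,1) time n is at least M; the vertices of [Chin E n v]
    then descend from [Chin E M v]. *)
Lemma Chin_nonempty (M : nat) v : large_A_sets -> Chin E M v !=set0.
Proof.
move=> FA; have FAv := FA 1 [set v] isT (finite_set1 v).
have [n Mn An] : exists2 n, (M <= n)%N & (\bigcap_(u in [set v]) A_set E X mu u 1) n.
  apply: contrapT => no.
  apply: (furstenberg_infinite F_furstenberg FAv).
  apply: sub_finite_set (finite_II M) => n An /=.
  by rewrite ltnNge; apply/negP => Mn; apply: no; exists n.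
have [_ [u]] := A_set_liftable (An v erefl).
by rewrite -(subnKC Mn) => /Chin_split[w vw _]; exists w.
Qed.

Lemma tilde_transitive_of_large_A_sets :
  large_A_sets -> set_transitive E X mu (tilde F).
Proof.
move=> FA U W [Usp Uo] [Wsp Wo] [f Uf] [h Wh] M.
have [wf wh] := (Usp _ Uf, Wsp _ Wh).
have [e e0 Ue] := Uo f Uf; have [d d0 Wd] := Wo h Wh.
have e20 : 0 < e / 2 by rewrite divr_gt0.
have [s [_ _ sf]] := comb_dense X_ok r wf e20.
(* The root is put into [t] so that at least one lift is available to bound the times from below. *)
have [t [_ rt th]] := comb_dense X_ok r wh (divr_gt0 d0 (ltr0Sn R 1)).
have ws : wsp (comb s f) by exact: wspace_comb.
have wt : wsp (comb t h) by exact: wspace_comb.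
have Wt : W (comb t h).
  apply: Wd => //; apply: le_lt_trans (space_normC X_ok wt wh) _.
  by apply: le_lt_trans th _; rewrite ltr_pdivrMr// ltr_pMr// ltr1n.
have [n0 sn0] := iter_shift_comb_eventually0 s f.
have [desc Hdesc] := choice (fun v => Chin_nonempty M v FA).
pose H := \sum_(v <- t) modulus (h v).
(* With this [N], the lift [g] of the target has N ||g|| ≤ H < N e / 2, hence norm below e / 2. *)
pose N := (Num.truncn (H / (e / 2))).+1.
have HN : H < N%:R * (e / 2) by rewrite -ltr_pdivrMr// truncnS_gt.
have N0 : 0 < N%:R :> R by rewrite ltr0n.
pose C := (modulus (mu (desc r)))^-1 * b ^+ (n0 + M).
(* Two demands: the first term pays for moving times by up to M, the second forces lifting times at
   [desc r] beyond n0 + M. *)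
pose N' := (Num.truncn (Num.max (N%:R * b ^+ (M + M)) C)).+1.
have /andP[NN' CN'] : (N%:R * b ^+ (M + M) <= N'%:R) && (C <= N'%:R).
  by rewrite -ge_max ltW// truncnS_gt.
exists (\bigcap_(v in [set desc v | v in [set` t]]) A_set E X mu v N').
  by apply: FA => //; apply: finite_image; exact: finite_seq.
move=> m [j Aj /andP[mj jm]].
have tj v : v \in t -> liftable (desc v) N'%:R j.
  by move=> vt; apply: (A_set_liftable (Aj _ _)).1; exists v.
have tm v : v \in t -> liftable v N%:R m.
  by move=> vt; exact: (liftable_near (ltW N0) (Hdesc v) mj jm NN' (tj v vt)).
(* From n0 + M < j and j ≤ m + M the time m exceeds n0, so the truncation of [f] is already
   annihilated. *)
have n0m : (n0 <= m)%N.
  by have := liftable_gt CN' (tj r rt) => /leq_trans/(_ jm); rewrite ltn_add2r => /ltnW.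
have [g [wg gm Ng]] := liftable_comb h (ltW N0) tm.
exists (comb t h); split=> //; exists (lin 1 (comb s f) g); last first.
  by rewrite iter_shift_lin// sn0// gm; apply/funext => v; rewrite /lin mulr0 add0r.
apply: Ue; first exact: wspace_lin.
have -> : lin 1 (comb s f) g \- f = lin 1 (comb s f \- f) g.
  by apply/funext => v; rewrite /lin /= !mul1r addrAC.
apply: le_lt_trans (space_norm_lin X_ok _ (wspaceB X_ok ws wf) wg) _.
rewrite modulus1 mul1r [e]splitr ler_ltD//.
  exact: le_trans (space_normC X_ok ws wf) sf.
by rewrite -(ltr_pM2l N0) (le_lt_trans Ng).
Qed.

Lemma transitive_of_tilde_transitive :
  set_transitive E X mu (tilde F) -> set_transitive E X mu F.
Proof.
move=> tr U W oU oW U0 W0; have [D FD DU] := tr U W oU oW U0 W0 0%N.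
apply: (furstenberg_upward F_furstenberg) FD _ => n Dn; apply: DU.
by exists n => //; rewrite addn0 leqnn.
Qed.

Lemma bounded_hitting_of_transitive : set_transitive E X mu F ->
  exists C : set (V -> K),
    [/\ norm_bounded X mu C, ~ C (fun=> 0) &
        forall W, weakly_open X mu W -> W !=set0 -> F (return_set E C W)].
Proof.
move=> tr; have wr : wsp (delta r) by exact: wspace_delta.
have [w0 _] := wspace0 mu X_ok.
(* The open ball about [delta r] whose radius is the norm of its centre: it is bounded and just
   misses 0. *)
exists [set g | wsp g /\ nrm (g \- delta r) < nrm (delta r)]; split.
- split=> [g []//|]; exists (nrm (delta r) + nrm (delta r)) => g [wg gr].
  have -> : g = lin 1 (g \- delta r) (delta r).
    by apply/funext => v; rewrite /lin /= mul1r subrK.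
  apply: le_trans (space_norm_lin X_ok _ (wspaceB X_ok wg wr) wr) _.
  by rewrite modulus1 mul1r lerD2r ltW.
- move=> [_]; rewrite ltNge => /negP; apply.
  have {1}-> : delta r = delta r \- (fun=> 0) :> (V -> K).
    by apply/funext => v; rewrite /= subr0.
  exact: space_normC.
- move=> W oW W0; apply: tr => //; first exact: norm_open_ball.
    exact: weakly_open_norm_open.
  exists (delta r); split=> //; rewrite (_ : _ \- _ = fun=> 0).
    apply: le_lt_trans (wspace0 mu X_ok).2 _; exact: space_norm_delta_gt0.
  by apply/funext => v; rewrite /= subrr.
Qed.

Lemma large_A_sets_of_bounded_hitting (C : set (V -> K)) : norm_bounded X mu C ->
  (forall W, weakly_open X mu W -> W !=set0 -> F (return_set E C W)) ->
  large_A_sets.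
Proof.
move=> [Csp [M CM]] hit N S N0 finS; pose s := fset_set S : seq V.
pose c := N%:R * `|M| + 1; have c0 : 0 <= c by rewrite addr_ge0// mulr_ge0.
have o := weakly_open_box X_ok mu_neq0 s (of_real c) 1.
apply: (furstenberg_upward F_furstenberg) (hit _ o _) _.
  exists (comb s (fun=> of_real c)); split; first exact: wspace_comb.
  by move=> v vs; rewrite combE ?fset_uniq// vs subrr modulus0.
move=> n [_ [[f Cf <-] [_ fc]]] v Sv.
apply: (A_set_of_iter N0 (Csp _ Cf)).
have := fc v; rewrite in_fset_set// inE => /(_ Sv).
set z := iter n _ f v => zc.
apply: (@le_lt_trans _ _ (N%:R * `|M|)).
  by rewrite ler_wpM2l// (le_trans (CM _ Cf))// ler_norm.
have := ler_modulusB (of_real c) z.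
rewrite modulus_of_real ger0_norm// -[modulus (_ - _)]modulusN opprB => cz.
by have := le_lt_trans cz zc; rewrite /c ltrBlDr [1 + _]addrC ltrD2r.
Qed.

Lemma large_A_sets_of_near_return :
  (forall (A : set nat) n, (0 < n)%N -> F A -> F (A `&` [set m | (n <= m)%N])) ->
  (forall g (U W : set (V -> K)), wsp g -> norm_open X mu U -> U g ->
     weakly_open X mu W -> W g -> F (return_set E U W)) ->
  large_A_sets.
Proof.
move=> F_tail near N S N0 finS; pose s := fset_set S : seq V.
pose g := comb s (fun=> 1 : K); have wg : wsp g by exact: wspace_comb.
have gE v : v \in s -> g v = 1.
  by move=> vs; rewrite /g combE ?fset_uniq// vs.
pose d : R := (N%:R * 2)^-1.
have d0 : 0 < d by rewrite invr_gt0 mulr_gt0 ?ltr0n.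
have gg0 : nrm (g \- g) < d.
  rewrite (_ : _ \- _ = fun=> 0); first exact: le_lt_trans (wspace0 mu X_ok).2 d0.
  by apply/funext => v; rewrite /= subrr.
have Fret : F (return_set E [set f | wsp f /\ nrm (f \- g) < d]
    [set f | wsp f /\ forall v, v \in s -> modulus (f v - 1) < 2^-1]).
  apply: (near g) => //; first exact: norm_open_ball.
    exact: weakly_open_box.
  by split=> // v /gE ->; rewrite subrr modulus0 invr_gt0.
have [n0 gn0] := iter_shift_comb_eventually0 s (fun=> 1 : K).
apply: (furstenberg_upward F_furstenberg) (F_tail _ n0.+1 isT Fret) _.
move=> n [[_ [[f [wf fd] <-] [_ f1]]] /ltnW/gn0 gn] v Sv.
apply: (A_set_of_iter N0 (wspaceB X_ok wf wg)).
have -> : iter n B (f \- g) = iter n B f.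
  by rewrite sub_lin iter_shift_lin// gn; apply/funext => u; rewrite /lin mulr0 add0r.
have := f1 v; rewrite in_fset_set// inE => /(_ Sv).
set z := iter n _ f v => z1.
have := ler_modulusB (1 : K) z; rewrite modulus1 -[modulus (_ - _)]modulusN opprB => zle.
have h : N%:R * nrm (f \- g) < 2^-1.
  have N0' : 0 < N%:R :> R by rewrite ltr0n.
  by rewrite mulrC -ltr_pdivlMr// -invfM mulrC.
lra.
Qed.

Lemma near_return_of_transitive : set_transitive E X mu F ->
  forall g (U W : set (V -> K)), wsp g -> norm_open X mu U -> U g ->
    weakly_open X mu W -> W g -> F (return_set E U W).
Proof.
move=> tr g U W _ oU Ug /(weakly_open_norm_open X_ok) oW Wg.
by apply: tr => //; exists g.
Qed.

Lemma large_A_sets_of_filter : family_filter F ->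
  (forall (N : nat) v, (0 < N)%N -> F (A_set E X mu v N)) -> large_A_sets.
Proof.
move=> FI FA N S N0 /finite_seqP[s ->]; elim: s => [|v s IH].
  have [A FA0] := furstenberg_nonempty F_furstenberg.
  by apply: (furstenberg_upward F_furstenberg) FA0 _ => n _ v.
apply: (furstenberg_upward F_furstenberg) (FI _ _ (FA N v N0) IH) _.
by move=> n [vn sn] u /=; rewrite inE => /predU1P[->//|us]; exact: sn.
Qed.

End Transitivity.

End Shift.

Theorem theorem4p1 (R : realType) (k : scalar_kind) (V : countType)
    (E : rel V) (mu : V -> scalar_field R k) (F : set (set nat)) (X : seq_space R) :
  directed_tree E -> rooted E ->
  (forall v, mu v != 0) ->
  furstenberg_family F ->
  exponent_ok X ->
  bounded_backward_shift E X mu ->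
  let c1 := set_transitive E X mu (tilde F) in
  let c2 := set_transitive E X mu F in
  let c3 := exists C : set (V -> scalar_field R k),
    [/\ norm_bounded X mu C, ~ C (fun=> 0) &
        forall W, weakly_open X mu W -> W !=set0 -> F (return_set E C W)] in
  let c4 := forall (N : nat) (S : set V), (0 < N)%N -> finite_set S ->
    F (\bigcap_(v in S) A_set E X mu v N) in
  let c5 := forall (g : V -> scalar_field R k) (U W : set (V -> scalar_field R k)),
    wspace X mu g -> norm_open X mu U -> U g -> weakly_open X mu W -> W g ->
    F (return_set E U W) in
  let c6 := forall (N : nat) (v : V), (0 < N)%N -> F (A_set E X mu v N) in
  [/\ [<-> c1; c2; c3; c4],
      (forall (A : set nat) (n : nat), (0 < n)%N -> F A ->
         F (A `&` [set m | (n <= m)%N])) ->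
      [<-> c1; c2; c3; c4; c5] &
      family_filter F -> [<-> c1; c2; c3; c4; c6]].
Proof.
move=> Et [r rE] mu0 Ff Xok [Bcvg Bwsp [M BM]] c1 c2 c3 c4 c5 c6.
pose b := 1 + `|M|; have b1 : 1 <= b by rewrite lerDl.
have Bb f : wspace X mu f ->
    space_norm X mu (backward_shift E f) <= b * space_norm X mu f.
  move=> wf; rewrite (le_trans (BM _ wf))// ler_wpM2r ?space_norm_ge0//.
  by rewrite (le_trans (ler_norm _))// lerDr.
have i12 : c1 -> c2 by exact: transitive_of_tilde_transitive.
have i23 : c2 -> c3 by exact: bounded_hitting_of_transitive.
have i34 : c3 -> c4.
  move=> [C [Cb _ hit]].
  exact: (large_A_sets_of_bounded_hitting Et Xok mu0 Bcvg Bwsp b1 Bb Ff Cb hit).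
have i41 : c4 -> c1.
  exact: (tilde_transitive_of_large_A_sets Et rE Xok mu0 Bcvg Bwsp b1 Bb Ff).
split=> [|tail|filt]; tfae => //.
- by move/i41/i12; exact: near_return_of_transitive.
- move=> h5; apply: i41.
  exact: (large_A_sets_of_near_return Et rE Xok mu0 Bcvg Bwsp b1 Bb Ff tail h5).
- move=> h4 N v N0; apply: (furstenberg_upward Ff) (h4 N [set v] N0 (finite_set1 v)) _.
  by move=> n; apply.
- by move=> h6; apply: i41; exact: large_A_sets_of_filter.
Qed.
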